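(* For a fixed $\lambda_0\in(b,a)$, consider the hyperboloid $\mathcal{Q}_{\lambda_0}$ and an arbitrary point $(x,y,z)$ on $\mathcal{Q}_{\lambda_0}$. The equation $$\frac{x^2}{a-\lambda}+\frac{y^2}{b-\lambda}+\frac{z^2}{c+\lambda}=1$$ in $\lambda$ has, along with $\lambda_0$, two other roots in $\mathbf{C}$: denote them by $\lambda_1$ and $\lambda_2$. Then $\lambda_1=\lambda_2$ if and only if $(x,y,z)$ is placed on a light-like tangent to a tropic curve of $\mathcal{Q}_{\lambda_0}$.
   Context: The three-dimensional Minkowski space $\mathbf{E}^{2,1}$ is $\mathbf{R}^3$ with coordinates $(x,y,z)$ and scalar product $\langle u,w\rangle=u_1w_1+u_2w_2-u_3w_3$. A line with direction vector $v\ne0$ is light-like if $\langle v,v\rangle=0$. Fix constants $a>b>0$, $c>0$. The confocal family is $$\mathcal{Q}_\lambda:\ \frac{x^2}{a-\lambda}+\frac{y^2}{b-\lambda}+\frac{z^2}{c+\lambda}=1,\qquad\lambda\in\mathbf{R};$$ for $\lambda\in(b,a)$ these are $1$-sheeted hyperboloids oriented along the $y$-axis. The tropic curves on $\mathcal{Q}_\lambda$ are the set of its points where the metric induced by $\langle\cdot,\cdot\rangle$ on the tangent plane is degenerate. The roots of the equation are those, with multiplicity, of the cubic polynomial in $\lambda$ obtained by clearing denominators. *)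

(* Defs.v *)
From HB Require Import structures.
From mathcomp Require Import all_boot all_order all_algebra.
From mathcomp Require Import all_classical all_reals all_analysis.
From mathcomp Require Export complex.

Set Implicit Arguments.
Unset Strict Implicit.
Unset Printing Implicit Defensive.

Import Order.TTheory GRing.Theory Num.Theory.
Import numFieldNormedType.Exports.

Local Open Scope classical_set_scope.
Local Open Scope ring_scope.

Section Minkowski.
Variable R : realType.
Implicit Types (p q u v w : 'rV[R]_3) (S : set 'rV[R]_3).

Definition mink u w : R := u 0 0 * w 0 0 + u 0 1 * w 0 1 - u 0 2 * w 0 2.

Definition light_like v : Prop := v != 0 /\ mink v v = 0.

Definition line q v : set 'rV[R]_3 := [set q + s *: v | s in [set: R]].

(* The curve need only be differentiable at 0. For an embedded C^1 submanifold
   [S] (any curve or surface below) the velocities of such curves are exactly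
   the vectors of its tangent space at [q], zero included. *)
Definition tangent_vector S q v : Prop :=
  exists gamma : R -> 'rV[R]_3,
    [/\ gamma 0 = q,
        \forall t \near (0 : R), S (gamma t)
      & is_derive (0 : R) (1 : R) gamma v].

Definition degenerate_on (T : set 'rV[R]_3) : Prop :=
  exists u, [/\ T u, u != 0 & forall w, T w -> mink u w = 0].

Definition tropic S : set 'rV[R]_3 :=
  [set q | S q /\ degenerate_on (tangent_vector S q)].

Definition on_light_like_tangent S p : Prop :=
  exists q v, [/\ S q, tangent_vector S q v, light_like v & line q v p].

(* Faithful only for l distinct from a, b and -c, because division by 0
   yields 0. *)
Definition quadric (a b c l : R) : set 'rV[R]_3 :=
  [set p | p 0 0 ^+ 2 / (a - l) + p 0 1 ^+ 2 / (b - l)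
           + p 0 2 ^+ 2 / (c + l) = 1].

(* (1 - x^2/(a-X) - y^2/(b-X) - z^2/(c+X)) * (a-X)(b-X)(c+X); with this sign
   the polynomial is monic of degree 3. *)
Definition confocal_cubic (a b c : R) p : {poly R} :=
  (a%:P - 'X) * (b%:P - 'X) * (c%:P + 'X)
  - p 0 0 ^+ 2 *: ((b%:P - 'X) * (c%:P + 'X))
  - p 0 1 ^+ 2 *: ((a%:P - 'X) * (c%:P + 'X))
  - p 0 2 ^+ 2 *: ((a%:P - 'X) * (b%:P - 'X)).

(* l1 and l2 are the roots, with multiplicity, remaining beside l0. *)
Definition other_roots (a b c l0 : R) p (l1 l2 : R[i]) : Prop :=
  map_poly (real_complex R) (confocal_cubic a b c p) =
    ('X - (l0%:C)%C%:P) * ('X - l1%:P) * ('X - l2%:P).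

End Minkowski.

(* Main.v *)
Require Import Defs.
From HB Require Import structures.
From mathcomp Require Import all_boot all_order all_algebra.
From mathcomp Require Import all_classical all_reals all_analysis.
From mathcomp Require Import ring lra.

(* Write the quadric as t0 x^2 + t1 y^2 - t2 z^2 = 1 with t = (1/T0, 1/T1, 1/T2),
   T = (a - l0, b - l0, -(c + l0)). The vector n = (t0 x, t1 y, t2 z) at (x, y, z)
   is Minkowski-orthogonal to the tangent plane, so the plane is degenerate iff n
   is null, and then n spans its only light-like direction. The normal line at a
   tropic point q is tangent to the tropic curve iff t0^3 x^2 + t1^3 y^2 = t2^3 z^2
   at q; together with the two equations of the tropic curve this determines the
   squared coordinates of q, so there are eight such lines, and at the parameter s
   on them x^2 = T0 (T0 + s)^2 / ((T0 - T1) (T0 - T2)), and likewise for y^2 and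
   -z^2 with the indices permuted. On the other hand, if l0 + m1 and l0 + m2 are
   the other two roots, evaluating the cubic at a, b and -c gives
   x^2 = T0 (T0 - m1) (T0 - m2) / ((T0 - T1) (T0 - T2)) and its permutations.
   Hence p lies on one of the eight lines iff m1 = m2 (= -s). *)

Import Order.TTheory GRing.Theory Num.Theory.
Import numFieldNormedType.Exports.
Local Open Scope classical_set_scope.
Local Open Scope ring_scope.

(** * The two roots besides [l0] *)

(** After cancelling [Y], two monic quadratics are compared at [Y] = 0 and [Y] = 1, which gives the
    product and then the sum of the shifted roots. *)
Lemma cubic_factorsP (F : fieldType) (z l1 l2 e1 e0 : F) :
  let Y := 'X - z%:P in
  Y * (Y ^+ 2 + e1%:P * Y + e0%:P) = Y * ('X - l1%:P) * ('X - l2%:P) <->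
  (l1 - z) + (l2 - z) = - e1 /\ (l1 - z) * (l2 - z) = e0.
Proof.
move=> Y; split=> [|[he1 <-]]; last first.
  by rewrite -[e1]opprK -he1 /Y; ring.
rewrite -mulrA => /(mulfI (negbT (polyXsubC_eq0 z))) e.
have ev x := congr1 (horner^~ x) e.
move: (ev z) (ev (z + 1)) => e0E e1E; rewrite !hornerE in e0E e1E.
have {}e0E : (l1 - z) * (l2 - z) = e0.
  by transitivity ((z - l1) * (z - l2)); [ring | rewrite -e0E; ring].
split=> //; transitivity ((l1 - z) * (l2 - z) + 1 - (z + 1 - l1) * (z + 1 - l2)).
  by ring.
by rewrite -e1E e0E; ring.
Qed.

Section Roots.
Set Implicit Arguments.
Unset Strict Implicit.
Variable R : realType.
Implicit Types (a b c : R) (p : 'rV[R]_3).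

(** Expansion of the cubic around [l0]. The minus signs in [T2] and [W2] make the coefficients
    symmetric in the three indices. *)
Lemma confocal_cubic_factor a b c (l0 : R) p :
  a - l0 != 0 -> b - l0 != 0 -> c + l0 != 0 -> quadric a b c l0 p ->
  let T0 := a - l0 in let T1 := b - l0 in let T2 := - (c + l0) in
  let W0 := p 0 0 ^+ 2 in let W1 := p 0 1 ^+ 2 in let W2 := - p 0 2 ^+ 2 in
  let Y := 'X - l0%:P in
  confocal_cubic a b c p = Y * (Y ^+ 2
     + (W0 + W1 + W2 - (T0 + T1 + T2))%:P * Y
     + (T0 * T1 + T0 * T2 + T1 * T2
        - (W0 * (T1 + T2) + W1 * (T0 + T2) + W2 * (T0 + T1)))%:P).
Proof.
rewrite /quadric /= => Ta Tb Tc hp.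
have {}hp : (a - l0) * (b - l0) * (c + l0)
  - p 0 0 ^+ 2 * ((b - l0) * (c + l0)) - p 0 1 ^+ 2 * ((a - l0) * (c + l0))
  - p 0 2 ^+ 2 * ((a - l0) * (b - l0)) = 0.
  have : (a - l0) * (b - l0) * (c + l0) *
      (p 0 0 ^+ 2 / (a - l0) + p 0 1 ^+ 2 / (b - l0) + p 0 2 ^+ 2 / (c + l0))
    = (a - l0) * (b - l0) * (c + l0) by rewrite hp mulr1.
  by move=> {1}<-; field; apply/and3P.
apply/eqP; rewrite -subr_eq0; apply/eqP.
(* The zero is replaced by the value of the cubic at [l0], as a constant polynomial; what remains is
   an identity. *)
rewrite -[RHS](congr1 polyC hp) /confocal_cubic -!mul_polyC.
ring.
Qed.

Lemma other_rootsP a b c (l0 : R) p (e1 e0 : R) (l1 l2 : R[i]) :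
  let Y := 'X - l0%:P in
  confocal_cubic a b c p = Y * (Y ^+ 2 + e1%:P * Y + e0%:P) ->
  other_roots a b c l0 p l1 l2 <->
  (l1 - l0%:C%C) + (l2 - l0%:C%C) = - e1%:C%C /\
  (l1 - l0%:C%C) * (l2 - l0%:C%C) = e0%:C%C.
Proof.
move=> Y cubicE; rewrite -cubic_factorsP /other_roots cubicE.
have := map_polyXsubC (real_complex R) l0; rewrite -/Y; move: Y {cubicE} => Y YE.
by rewrite !(rmorphM, rmorphD, rmorphXn) /= !map_polyC YE.
Qed.

Lemma other_roots_exist a b c (l0 : R) p (e1 e0 : R) :
  let Y := 'X - l0%:P in
  confocal_cubic a b c p = Y * (Y ^+ 2 + e1%:P * Y + e0%:P) ->
  exists l1 l2, other_roots a b c l0 p l1 l2.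
Proof.
move=> Y cubicE; pose d := sqrtc (e1 ^+ 2 - 4 * e0)%:C%C.
exists (l0%:C%C + (- e1%:C%C + d) / 2), (l0%:C%C + (- e1%:C%C - d) / 2).
apply/(other_rootsP _ _ cubicE); split; first by field.
transitivity ((e1%:C%C ^+ 2 - d ^+ 2) / 4); first by field.
by rewrite sqr_sqrtc; field.
Qed.

(** [(l1 - l2) ^+ 2] is the discriminant of the quadratic in [Y]. *)
Lemma other_roots_eq a b c (l0 : R) p (e1 e0 : R) (l1 l2 : R[i]) :
  let Y := 'X - l0%:P in
  confocal_cubic a b c p = Y * (Y ^+ 2 + e1%:P * Y + e0%:P) ->
  other_roots a b c l0 p l1 l2 -> l1 = l2 <-> e1 ^+ 2 = 4 * e0.
Proof.
move=> Y cubicE /(other_rootsP _ _ cubicE)[he1 he0].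
have disc : (l1 - l2) ^+ 2 = (e1 ^+ 2 - 4 * e0)%:C%C.
  transitivity (e1%:C%C ^+ 2 - 4 * e0%:C%C); last by rewrite rmorphB rmorphXn rmorphM rmorph_nat.
  by rewrite -he0 -[e1%:C%C]opprK -he1; ring.
split=> [l12|e1E].
  apply/eqP; rewrite -subr_eq0; apply/eqP/complexI.
  by rewrite -disc l12 subrr expr0n.
by apply/eqP; rewrite -subr_eq0 -sqrf_eq0 disc e1E subrr.
Qed.
End Roots.

(** * Tangent vectors and tropic curves of a diagonal quadric *)

Lemma forall_ord3 (P : 'I_3 -> Prop) : P 0 -> P 1 -> P 2 -> forall i, P i.
Proof.
move=> P0 P1 P2 [[|[|[|//]]] hi].
- by rewrite (_ : Ordinal hi = 0) //; apply: val_inj.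
- by rewrite (_ : Ordinal hi = 1) //; apply: val_inj.
- by rewrite (_ : Ordinal hi = 2) //; apply: val_inj.
Qed.

Section Geometry.
Set Implicit Arguments.
Unset Strict Implicit.
Variable R : realType.
Implicit Types (t p q u v w : 'rV[R]_3).

Lemma scaleRE (x y : R) : x *: y = x * y. Proof. by []. Qed.

(* Half the gradient at [q] of the form defining [dquadric t], raised by the Minkowski
   metric; this is why the third term of that form carries a minus sign. *)
Definition mink_normal t q : 'rV[R]_3 := \row_i (t 0 i * q 0 i).

Definition dquadric t : set 'rV[R]_3 := [set q | mink (mink_normal t q) q = 1].

Lemma row3P u v :
  [/\ u 0 0 = v 0 0, u 0 1 = v 0 1 & u 0 2 = v 0 2] -> u = v.
Proof. by case=> e0 e1 e2; apply/rowP; apply: forall_ord3. Qed.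

Lemma is_derive_row {n} (gamma : R -> 'rV[R]_n) (v : 'rV[R]_n) (x : R) :
  is_derive x 1 gamma v <-> forall i, is_derive x 1 (fun s => gamma s 0 i) (v 0 i).
Proof.
split=> [[dg <-] i|dgi].
  apply: DeriveDef; first by have /derivable_mxP := dg.
  by rewrite derive_mx// mxE.
have dg : derivable gamma x 1.
  by apply/derivable_mxP => i j; rewrite ord1; case: (dgi j).
apply: DeriveDef => //; apply/rowP => j; rewrite derive_mx// mxE.
by case: (dgi j).
Qed.

(** The derivative of a quadratic form along a curve is twice its polar form at position and
    velocity. *)
Lemma derive_mink_normal t (gamma : R -> 'rV[R]_3) v (k : R) :
  is_derive (0 : R) 1 gamma v ->
  (\forall s \near (0 : R), mink (mink_normal t (gamma s)) (gamma s) = k) ->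
  mink (mink_normal t (gamma 0)) v = 0.
Proof.
move=> /is_derive_row dg near_k.
have h0 := dg 0; have h1 := dg 1; have h2 := dg 2.
have : is_derive (0 : R) 1 (cst k) (2 * mink (mink_normal t (gamma 0)) v).
  apply: (@near_eq_is_derive _ _ _ (fun s => mink (mink_normal t (gamma s)) (gamma s))).
    exact: near_k.
  pose g i s := gamma s 0 i.
  have -> : (fun s => mink (mink_normal t (gamma s)) (gamma s)) =
     t 0 0 \*: g 0 ^+ 2 + t 0 1 \*: g 1 ^+ 2 - t 0 2 \*: g 2 ^+ 2.
    by apply/funext => s; rewrite /mink !mxE /g !fctE /= !scaleRE; ring.
  apply: is_derive_eq.
  by rewrite /mink /mink_normal !mxE /g ?scaleRE; ring.
move=> [_]; rewrite derive_cst => /esym/eqP.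
by rewrite mulf_eq0 pnatr_eq0 /= => /eqP.
Qed.

(* The velocity [v] is realised by rescaling the line [q + s v] onto the quadric. *)
Lemma tangent_dquadric t q v : dquadric t q ->
  tangent_vector (dquadric t) q v <-> mink (mink_normal t q) v = 0.
Proof.
rewrite {1}/dquadric /= => hq; split=> [[gamma [<- near_g dg]]|hv].
  exact: derive_mink_normal dg near_g.
pose k := mink (mink_normal t v) v.
have formE s r : mink (mink_normal t (r *: (q + s *: v))) (r *: (q + s *: v))
    = r ^+ 2 * (1 + k * s ^+ 2).
  rewrite -hq; transitivity (r ^+ 2 *
     (mink (mink_normal t q) q + 2 * s * mink (mink_normal t q) v + k * s ^+ 2)).
    by rewrite /k /mink /mink_normal !mxE; ring.
  by rewrite hv; ring.
(* This factor has derivative 0 at 0, so the rescaled curve keeps the velocity [v]. As [k] may be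
   negative, the root is controlled only near 0. *)
pose r s := (Num.sqrt (1 + k * s ^+ 2))^-1.
exists (fun s => r s *: (q + s *: v)); split.
- by rewrite /r expr0n/= mulr0 addr0 sqrtr1 invr1 scale0r addr0 scale1r.
- have : (fun s : R => 1 + k * s ^+ 2) s @[s --> (0 : R)] --> 1 + k * 0 ^+ 2.
    by apply: cvgD; [exact: cvg_cst | apply: cvgM; [exact: cvg_cst | exact: exprn_continuous]].
  rewrite expr0n mulr0 addr0 => /cvgr_gt/(_ 0 ltr01); apply: filterS => s s0.
  rewrite /dquadric/= formE /r exprVn sqr_sqrtr ?ltW// mulVf//.
  by rewrite gt_eqF.
- apply/is_derive_row => i.
  have d1 : is_derive (0 : R) 1 (fun s : R => 1 + k * s ^+ 2) 0.
    have -> : (fun s : R => 1 + k * s ^+ 2) = cst 1 + k \*: (id ^+ 2 : R -> R).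
      by apply/funext => s; rewrite !fctE.
    by apply: is_derive_eq; rewrite /= ?scaleRE; ring.
  have s1 : is_derive (1 + k * 0 ^+ 2 : R) 1 Num.sqrt (2 * Num.sqrt (1 + k * 0 ^+ 2))^-1.
    by apply: is_derive1_sqrt; rewrite expr0n/= mulr0 addr0.
  have d2 := @is_derive1_comp _ Num.sqrt (fun s => 1 + k * s ^+ 2) 0 _ _ s1 d1.
  have d3 : is_derive (0 : R) 1 r 0.
    apply: is_derive_eq; first by apply: is_deriveV d2; rewrite /= expr0n/= mulr0 addr0 sqrtr1 oner_eq0.
    by rewrite mulr0 scaler0.
  have -> : (fun s => (r s *: (q + s *: v)) 0 i) = r * (cst (q 0 i) + v 0 i \*: id).
    by apply/funext => s; rewrite !mxE !fctE /= ?scaleRE; ring.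
  apply: is_derive_eq.
  rewrite /r expr0n/= mulr0 addr0 sqrtr1 invr1 !fctE /= ?scaleRE; ring.
Qed.

Lemma mink_normal_neq0 t q : dquadric t q -> mink_normal t q != 0.
Proof.
rewrite /dquadric/= => hq; apply/eqP => n0; move: hq; rewrite n0.
by rewrite /mink !mxE !mul0r subr0 addr0 => /esym/eqP; rewrite oner_eq0.
Qed.

(** The tangent plane is the orthogonal complement of the normal [n], so a vector orthogonal to all
    of it is proportional to [n]; if it also lies in the plane and is nonzero, [n] is null. *)
Lemma tropic_dquadricE t :
  tropic (dquadric t) = [set q | dquadric t q /\
    mink (mink_normal t q) (mink_normal t q) = 0].
Proof.
apply/seteqP; split=> q /= [hq].
- case=> u [/(tangent_dquadric u hq) nu u0 orth]; split=> //.
  set n := mink_normal t q in nu orth *.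
  have orthn w : mink n w = 0 -> mink u w = 0.
    by move=> nw; apply/orth/(tangent_dquadric _ hq).
  (* Three test vectors orthogonal to [n] make the 2x2 minors of [u] and [n] vanish. *)
  have e01 : u 0 0 * n 0 1 = u 0 1 * n 0 0.
    have := orthn (n 0 1 *: delta_mx 0 0 - n 0 0 *: delta_mx 0 1).
    rewrite /mink !mxE /= => h; apply/eqP; rewrite -subr_eq0; apply/eqP.
    by rewrite -[RHS]h; ring.
  have e02 : u 0 0 * n 0 2 = u 0 2 * n 0 0.
    have := orthn (n 0 2 *: delta_mx 0 0 + n 0 0 *: delta_mx 0 2).
    rewrite /mink !mxE /= => h; apply/eqP; rewrite -subr_eq0; apply/eqP.
    by rewrite -[RHS]h; ring.
  have e12 : u 0 1 * n 0 2 = u 0 2 * n 0 1.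
    have := orthn (n 0 2 *: delta_mx 0 1 + n 0 1 *: delta_mx 0 2).
    rewrite /mink !mxE /= => h; apply/eqP; rewrite -subr_eq0; apply/eqP.
    by rewrite -[RHS]h; ring.
  apply/eqP/negPn/negP => nn0; case/eqP: u0; apply: row3P; rewrite !mxE.
  have un0 i : (forall j, u 0 i * n 0 j = u 0 j * n 0 i) -> u 0 i = 0.
    move=> un; apply: (mulIf nn0); rewrite mul0r.
    transitivity (n 0 0 * (u 0 i * n 0 0) + n 0 1 * (u 0 i * n 0 1)
                  - n 0 2 * (u 0 i * n 0 2)); first by rewrite /mink; ring.
    by rewrite !un; transitivity (n 0 i * mink n u); [rewrite /mink; ring | rewrite nu mulr0].
  by split; apply: un0; apply: forall_ord3.
- move=> nn; split=> //; exists (mink_normal t q); split.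
  + exact/(tangent_dquadric _ hq).
  + exact: mink_normal_neq0.
  + by move=> w /(tangent_dquadric _ hq).
Qed.

(** Equality case of Cauchy-Schwarz in the first two coordinates. *)
Lemma null_orthogonal_colinear u v : u != 0 -> mink u u = 0 -> mink v v = 0 ->
  mink u v = 0 -> exists k, v = k *: u.
Proof.
rewrite /mink => u0 uu vv uv.
have {}uu : u 0 0 ^+ 2 + u 0 1 ^+ 2 = u 0 2 ^+ 2 by lra.
have {}vv : v 0 0 ^+ 2 + v 0 1 ^+ 2 = v 0 2 ^+ 2 by lra.
have {}uv : u 0 0 * v 0 0 + u 0 1 * v 0 1 = u 0 2 * v 0 2 by lra.
have cross : u 0 0 * v 0 1 = u 0 1 * v 0 0.
  apply/eqP; rewrite -subr_eq0 -sqrf_eq0; apply/eqP.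
  (* Lagrange's identity. *)
  transitivity ((u 0 0 ^+ 2 + u 0 1 ^+ 2) * (v 0 0 ^+ 2 + v 0 1 ^+ 2)
                - (u 0 0 * v 0 0 + u 0 1 * v 0 1) ^+ 2); first by ring.
  by rewrite uu vv uv; ring.
have u2 : u 0 2 != 0.
  apply: contra u0 => /eqP u2; move: uu; rewrite u2 expr0n => /eqP.
  rewrite paddr_eq0 ?sqr_ge0// !sqrf_eq0 => /andP[/eqP u0 /eqP u1].
  by apply/eqP/row3P; rewrite !mxE.
exists (v 0 2 / u 0 2); apply: row3P; rewrite !mxE divfK//; split=> //.
- apply: (mulfI (expf_neq0 2 u2)); rewrite -[LHS](congr1 ( *%R^~ _) uu).
  transitivity (u 0 0 * (u 0 2 * v 0 2)); last by field.
  by rewrite -uv mulrDr mulrDl (mulrCA _ (u 0 1)) cross; ring.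
- apply: (mulfI (expf_neq0 2 u2)); rewrite -[LHS](congr1 ( *%R^~ _) uu).
  transitivity (u 0 1 * (u 0 2 * v 0 2)); last by field.
  rewrite -uv mulrDr mulrDl (mulrCA _ (u 0 0)) -cross; ring.
Qed.

Lemma is_derive_sqrt_affine (k : R) :
  is_derive (0 : R) 1 (fun s => Num.sqrt (1 + 2 * k * s)) k.
Proof.
have d1 : is_derive (0 : R) 1 (fun s : R => 1 + 2 * k * s) (2 * k).
  have -> : (fun s : R => 1 + 2 * k * s) = cst 1 + (2 * k) \*: id.
    by apply/funext => s; rewrite !fctE.
  by apply: is_derive_eq; rewrite scaleRE; ring.
have s1 : is_derive (1 + 2 * k * 0 : R) 1 Num.sqrt (2 * Num.sqrt (1 + 2 * k * 0))^-1.
  by apply: is_derive1_sqrt; rewrite mulr0 addr0.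
apply: is_derive_eq (@is_derive1_comp _ Num.sqrt _ 0 _ _ s1 d1) _.
by rewrite mulr0 addr0 sqrtr1; field.
Qed.

(* The curve [s |-> (q_i sqrt (1 + 2 t_i s))_i] has velocity [n], and both
   equations of the tropic curve are affine in [s] along it. *)
Lemma tangent_tropic_normal t q :
  let n := mink_normal t q in
  dquadric t q -> mink n n = 0 -> mink (mink_normal t n) n = 0 ->
  tangent_vector (tropic (dquadric t)) q n.
Proof.
rewrite tropic_dquadricE /dquadric /= => hq nn tnn.
pose x i s : R := 1 + 2 * t 0 i * s.
exists (fun s => \row_i (q 0 i * Num.sqrt (x i s))); split.
- by apply/rowP => i; rewrite mxE /x mulr0 addr0 sqrtr1 mulr1.
- have x_gt0 i : \forall s \near (0 : R), 0 < x i s.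
    have : x i s @[s --> (0 : R)] --> x i 0.
      apply: cvgD; first exact: cvg_cst.
      by apply: cvgM; [exact: cvg_cst | exact: cvg_id].
    by rewrite {2}/x mulr0 addr0 => /cvgr_gt/(_ 0 ltr01).
  have {}x_gt0 : \forall s \near (0 : R), forall i, 0 < x i s.
    exact: (@filter_forall _ _ (fun i s => 0 < x i s) (nbhs (0 : R)) _ x_gt0).
  apply: filterS x_gt0 => s x_gt0.
  have xE i : Num.sqrt (x i s) ^+ 2 = 1 + 2 * t 0 i * s by rewrite sqr_sqrtr ?ltW.
  have sqE a i : a * (q 0 i * Num.sqrt (x i s)) * (q 0 i * Num.sqrt (x i s))
      = a * q 0 i ^+ 2 * (1 + 2 * t 0 i * s) by rewrite -xE; ring.
  move: hq nn tnn; rewrite /mink /= !mxE !sqE => hq nn tnn.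
  have sqE' i : t 0 i * (q 0 i * Num.sqrt (x i s)) * (t 0 i * (q 0 i * Num.sqrt (x i s)))
      = t 0 i ^+ 2 * q 0 i ^+ 2 * (1 + 2 * t 0 i * s) by rewrite -xE; ring.
  rewrite !sqE'; split.
  (* The slopes in [s] of the two equations are twice [mink n n] and twice
     [mink (mink_normal t n) n]. *)
  + have := congr1 ( *%R (2 * s)) nn; lra.
  + have := congr1 ( *%R (2 * s)) tnn; lra.
- apply/is_derive_row => i; rewrite mxE.
  have d := is_derive_sqrt_affine (t 0 i).
  have -> : (fun s => (\row_i (q 0 i * Num.sqrt (x i s))) 0 i) =
      q 0 i \*: (fun s => Num.sqrt (1 + 2 * t 0 i * s)).
    by apply/funext => s; rewrite mxE.
  by apply: is_derive_eq; rewrite scaleRE mulrC.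
Qed.

(* A null vector in the degenerate tangent plane is a multiple of the normal, so
   a light-like tangent is the normal line, and it is tangent to the tropic curve
   exactly when the quadric contains it. *)
Lemma on_light_like_tangent_tropicE t p :
  on_light_like_tangent (tropic (dquadric t)) p <->
  exists q s, let n := mink_normal t q in
    [/\ mink n q = 1, mink n n = 0, mink (mink_normal t n) n = 0
      & p = q + s *: n].
Proof.
split=> [[q [v []]]|[q [s]]] /=.
- rewrite {1}tropic_dquadricE => -[hq nn] [gamma [g0 near_g dg]] [v0 vv] [s _ <-].
  set n := mink_normal t q in nn *.
  rewrite tropic_dquadricE in near_g.
  have nv : mink n v = 0.
    rewrite /n -g0; apply: (@derive_mink_normal _ _ _ 1 dg).
    by apply: filterS near_g => r [].
  have tnv : mink (mink_normal t n) v = 0.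
    (* The null condition on the normal is itself a diagonal form in the point, with weights
       [t 0 i ^+ 2]. *)
    transitivity (mink (mink_normal (\row_i (t 0 i ^+ 2)) (gamma 0)) v).
      by rewrite g0 /n /mink !mxE; ring.
    apply: (@derive_mink_normal _ _ _ 0 dg).
    by apply: filterS near_g => r [_ <-]; rewrite /mink !mxE; ring.
  have [k vE] := null_orthogonal_colinear (mink_normal_neq0 hq) nn vv nv.
  have k0 : k != 0 by apply: contra v0 => /eqP k0; rewrite vE k0 scale0r.
  exists q, (s * k); split=> //; last by rewrite vE scalerA.
  apply: (mulfI k0); rewrite mulr0 -tnv vE.
  by rewrite /mink !mxE; ring.
- move=> [hq nn tnn ->]; exists q, (mink_normal t q); split.
  + by rewrite tropic_dquadricE.
  + exact: tangent_tropic_normal.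
  + by split=> //; exact: mink_normal_neq0.
  + by exists s.
Qed.
End Geometry.

(** * The eight normal lines and the double root *)

(** The sign of [q] is adapted to [x]; over three coordinates this selects one of the eight
    lines. *)
Lemma sqr_scaled (R : rcfType) (x r c : R) :
  0 <= c -> x ^+ 2 = c * r ^+ 2 -> exists2 q, q ^+ 2 = c & x = q * r.
Proof.
move=> c0; rewrite -[c]sqr_sqrtr// -exprMn => /eqP; rewrite eqf_sqr.
case/orP => /eqP ->; first by exists (Num.sqrt c).
by exists (- Num.sqrt c); rewrite ?sqrrN ?mulNr.
Qed.

Section Main.
Set Implicit Arguments.
Unset Strict Implicit.
Variable R : realType.

Definition inv_row (T0 T1 T2 : R) : 'rV[R]_3 := \row_i [:: T0^-1; T1^-1; T2^-1]`_i.

(** The signs and order of the [T] make the squared coordinates of the tropic point nonnegative in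
    the converse. *)
Lemma normal_line_discriminant (T0 T1 T2 : R) (p : 'rV[R]_3) :
  0 < T0 -> T1 < 0 -> T2 < T1 ->
  let t := inv_row T0 T1 T2 in
  let W0 := p 0 0 ^+ 2 in let W1 := p 0 1 ^+ 2 in let W2 := - p 0 2 ^+ 2 in
  mink (mink_normal t p) p = 1 ->
  (exists q s, let n := mink_normal t q in
    [/\ mink n q = 1, mink n n = 0, mink (mink_normal t n) n = 0
      & p = q + s *: n]) <->
  (W0 + W1 + W2 - (T0 + T1 + T2)) ^+ 2 = 4 *
   (T0 * T1 + T0 * T2 + T1 * T2
        - (W0 * (T1 + T2) + W1 * (T0 + T2) + W2 * (T0 + T1))).
Proof.
move=> T0_gt0 T1_lt0 T21 t W0 W1 W2 hp.
have T0n : T0 != 0 by rewrite gt_eqF.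
have T1n : T1 != 0 by rewrite lt_eqF.
have T2n : T2 != 0 by rewrite lt_eqF// (lt_trans T21).
pose S1 := T0 + T1 + T2; pose S2 := T0 * T1 + T0 * T2 + T1 * T2.
split.
- case=> q [s /= [hq nn tnn pE]].
  move: hq nn tnn.
  rewrite /W0 /W1 /W2 pE /mink /t /inv_row !mxE /=.
  move: (q 0 0) (q 0 1) (q 0 2) => x y z hq nn tnn.
  (* With these weights the three conditions say that the moments of order 0, 1, 2 at the nodes
     [T0], [T1], [T2] are 0, 0, 1. *)
  pose o0 := x ^+ 2 / T0 ^+ 3; pose o1 := y ^+ 2 / T1 ^+ 3; pose o2 := - z ^+ 2 / T2 ^+ 3.
  have xE : x ^+ 2 = T0 ^+ 3 * o0 by rewrite /o0; field.
  have yE : y ^+ 2 = T1 ^+ 3 * o1 by rewrite /o1; field.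
  have zE : z ^+ 2 = - (T2 ^+ 3 * o2) by rewrite /o2; field.
  have h3 : o0 + o1 + o2 = 0 by rewrite -tnn /o0 /o1 /o2; field; apply/and3P.
  have h2 : T0 * o0 + T1 * o1 + T2 * o2 = 0 by rewrite -nn /o0 /o1 /o2; field; apply/and3P.
  have h1 : T0 ^+ 2 * o0 + T1 ^+ 2 * o1 + T2 ^+ 2 * o2 = 1.
    by rewrite -hq /o0 /o1 /o2; field; apply/and3P.
  (* The moments of (o0, o1, o2) at the nodes T0, T1, T2 satisfy the recurrence
     with characteristic polynomial (X - T0) (X - T1) (X - T2). *)
  have h0 : T0 ^+ 3 * o0 + T1 ^+ 3 * o1 + T2 ^+ 3 * o2 = S1.
    transitivity (S1 * (T0 ^+ 2 * o0 + T1 ^+ 2 * o1 + T2 ^+ 2 * o2)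
      - S2 * (T0 * o0 + T1 * o1 + T2 * o2) + T0 * T1 * T2 * (o0 + o1 + o2)).
      by rewrite /S1 /S2; ring.
    by rewrite h1 h2 h3; ring.
  have hN : T0 ^+ 4 * o0 + T1 ^+ 4 * o1 + T2 ^+ 4 * o2 = S1 ^+ 2 - S2.
    transitivity (S1 * (T0 ^+ 3 * o0 + T1 ^+ 3 * o1 + T2 ^+ 3 * o2)
      - S2 * (T0 ^+ 2 * o0 + T1 ^+ 2 * o1 + T2 ^+ 2 * o2)
      + T0 * T1 * T2 * (T0 * o0 + T1 * o1 + T2 * o2)); first by rewrite /S1 /S2; ring.
    by rewrite h0 h1 h2; ring.
  (* Signed squared coordinate of [p], as each coordinate of [q] is scaled by [1 + s / T]. *)
  pose P T o := T * (T + s) ^+ 2 * o.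
  have hW : P T0 o0 + P T1 o1 + P T2 o2 = S1 + 2 * s.
    transitivity ((T0 ^+ 3 * o0 + T1 ^+ 3 * o1 + T2 ^+ 3 * o2)
      + 2 * s * (T0 ^+ 2 * o0 + T1 ^+ 2 * o1 + T2 ^+ 2 * o2)
      + s ^+ 2 * (T0 * o0 + T1 * o1 + T2 * o2)); first by rewrite /P; ring.
    by rewrite h0 h1 h2; ring.
  have hWT : T0 * P T0 o0 + T1 * P T1 o1 + T2 * P T2 o2 = S1 ^+ 2 - S2 + 2 * s * S1 + s ^+ 2.
    transitivity ((T0 ^+ 4 * o0 + T1 ^+ 4 * o1 + T2 ^+ 4 * o2)
      + 2 * s * (T0 ^+ 3 * o0 + T1 ^+ 3 * o1 + T2 ^+ 3 * o2)
      + s ^+ 2 * (T0 ^+ 2 * o0 + T1 ^+ 2 * o1 + T2 ^+ 2 * o2)); first by rewrite /P; ring.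
    by rewrite hN h0 h1; ring.
  have p0E : (x + s * (T0^-1 * x)) ^+ 2 = P T0 o0.
    by transitivity (x ^+ 2 * (1 + s / T0) ^+ 2); [ring | rewrite xE /P; field].
  have p1E : (y + s * (T1^-1 * y)) ^+ 2 = P T1 o1.
    by transitivity (y ^+ 2 * (1 + s / T1) ^+ 2); [ring | rewrite yE /P; field].
  have p2E : - (z + s * (T2^-1 * z)) ^+ 2 = P T2 o2.
    by transitivity (- z ^+ 2 * (1 + s / T2) ^+ 2); [ring | rewrite zE /P; field].
  rewrite p0E p1E p2E hW.
  transitivity (4 * (S2 - (S1 * (P T0 o0 + P T1 o1 + P T2 o2)
    - (T0 * P T0 o0 + T1 * P T1 o1 + T2 * P T2 o2)))); last by rewrite /S1 /S2; ring.
  by rewrite hW hWT /S1 /S2; ring.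
- set e1 := _ - (T0 + T1 + T2); set e0 := _ - (W0 * _ + _ + _) => disc.
  (* The quadratic is now [(Y + s) ^+ 2], and [s] is the parameter of [p] on its line. *)
  pose s := e1 / 2.
  have e0E : e0 = s ^+ 2 by rewrite /s; lra.
  have e1E : e1 = 2 * s by rewrite /s; field.
  have T01 : T0 - T1 != 0 by rewrite subr_eq0 gt_eqF// (lt_trans T1_lt0).
  have T02 : T0 - T2 != 0 by rewrite subr_eq0 gt_eqF// (lt_trans T21)// (lt_trans T1_lt0).
  have T12 : T1 - T2 != 0 by rewrite subr_eq0 gt_eqF.
  have T10 : T1 - T0 != 0 by rewrite -opprB oppr_eq0.
  have T20 : T2 - T0 != 0 by rewrite -opprB oppr_eq0.
  have T21' : T2 - T1 != 0 by rewrite -opprB oppr_eq0.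
  pose nz := (T0n, T1n, T2n, T01, T02, T12, T10, T20, T21').
  move: hp; rewrite /mink /t /inv_row !mxE /= => hp.
  have hp' : W0 * (T1 * T2) + W1 * (T0 * T2) + W2 * (T0 * T1) = T0 * T1 * T2.
    by rewrite -[RHS]mulr1 -hp /W0 /W1 /W2; field; rewrite !nz.
  have p0E : p 0 0 ^+ 2 = T0 ^+ 3 / ((T0 - T1) * (T0 - T2)) * (1 + s / T0) ^+ 2.
    (* The quadratic at [Y = T0]: by [hp'] only the [W0] term survives. *)
    transitivity (T0 * (T0 ^+ 2 + e1 * T0 + e0) / ((T0 - T1) * (T0 - T2))).
      have -> : T0 * (T0 ^+ 2 + e1 * T0 + e0) = W0 * ((T0 - T1) * (T0 - T2)).
        by rewrite /e1 /e0; lra.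
      by rewrite /W0 /W1; field; rewrite !nz.
    by rewrite e0E e1E; field; rewrite !nz.
  have p1E : p 0 1 ^+ 2 = T1 ^+ 3 / ((T1 - T0) * (T1 - T2)) * (1 + s / T1) ^+ 2.
    transitivity (T1 * (T1 ^+ 2 + e1 * T1 + e0) / ((T1 - T0) * (T1 - T2))).
      have -> : T1 * (T1 ^+ 2 + e1 * T1 + e0) = W1 * ((T1 - T0) * (T1 - T2)).
        by rewrite /e1 /e0; lra.
      by rewrite /W0 /W1; field; rewrite !nz.
    by rewrite e0E e1E; field; rewrite !nz.
  have p2E : p 0 2 ^+ 2 = - (T2 ^+ 3 / ((T2 - T0) * (T2 - T1))) * (1 + s / T2) ^+ 2.
    transitivity (- (T2 * (T2 ^+ 2 + e1 * T2 + e0) / ((T2 - T0) * (T2 - T1)))).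
      have -> : T2 * (T2 ^+ 2 + e1 * T2 + e0) = W2 * ((T2 - T0) * (T2 - T1)).
        by rewrite /e1 /e0; lra.
      by rewrite /W2; field; rewrite !nz.
    by rewrite e0E e1E; field; rewrite !nz.
  have c0 : 0 <= T0 ^+ 3 / ((T0 - T1) * (T0 - T2)).
    by rewrite divr_ge0 ?exprn_ge0 ?mulr_ge0//; lra.
  have c1 : 0 <= T1 ^+ 3 / ((T1 - T0) * (T1 - T2)).
    have -> : T1 ^+ 3 / ((T1 - T0) * (T1 - T2)) = (- T1) ^+ 3 / ((T0 - T1) * (T1 - T2)).
      by field; rewrite !nz.
    by rewrite divr_ge0 ?exprn_ge0 ?mulr_ge0//; lra.
  have c2 : 0 <= - (T2 ^+ 3 / ((T2 - T0) * (T2 - T1))).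
    have -> : - (T2 ^+ 3 / ((T2 - T0) * (T2 - T1))) = (- T2) ^+ 3 / ((T0 - T2) * (T1 - T2)).
      by field; rewrite !nz.
    by rewrite divr_ge0 ?exprn_ge0 ?mulr_ge0//; lra.
  have [x xE p0x] := sqr_scaled c0 p0E.
  have [y yE p1y] := sqr_scaled c1 p1E.
  have [z zE p2z] := sqr_scaled c2 p2E.
  (* The conditions become Lagrange's identities: the sum of T_i^k over the product of the T_i - T_j
     is 1, 0, 0 for k = 2, 1, 0. *)
  exists (\row_i [:: x; y; z]`_i), s => /=; rewrite /mink !mxE /=; split.
  + transitivity (x ^+ 2 / T0 + y ^+ 2 / T1 - z ^+ 2 / T2); first by ring.
    by rewrite xE yE zE; field; rewrite !nz.
  + transitivity (x ^+ 2 / T0 ^+ 2 + y ^+ 2 / T1 ^+ 2 - z ^+ 2 / T2 ^+ 2); first by field; rewrite !nz.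
    by rewrite xE yE zE; field; rewrite !nz.
  + transitivity (x ^+ 2 / T0 ^+ 3 + y ^+ 2 / T1 ^+ 3 - z ^+ 2 / T2 ^+ 3); first by field; rewrite !nz.
    by rewrite xE yE zE; field; rewrite !nz.
  + by apply: row3P; rewrite !mxE /= p0x p1y p2z; split; ring.
Qed.
End Main.

Theorem proposition4p11 (R : realType) (a b c l0 : R)
    (hb : 0 < b) (hab : b < a) (hc : 0 < c) (hbl : b < l0) (hla : l0 < a)
    (p : 'rV[R]_3) (hp : quadric a b c l0 p) :
  (exists l1 l2 : R[i], other_roots a b c l0 p l1 l2) /\
  (forall l1 l2 : R[i], other_roots a b c l0 p l1 l2 ->
     (l1 = l2 <-> on_light_like_tangent (tropic (quadric a b c l0)) p)).
Proof.
have a_gt0 : 0 < a - l0 by lra.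
have b_lt0 : b - l0 < 0 by lra.
have c_lt : - (c + l0) < b - l0 by lra.
have c_gt0 : 0 < c + l0 by lra.
have cubicE := confocal_cubic_factor (lt0r_neq0 a_gt0) (ltr0_neq0 b_lt0)
  (lt0r_neq0 c_gt0) hp.
(* The sign of the third entry cancels the minus sign in [mink]. *)
have quadricE : quadric a b c l0 =
    dquadric (inv_row (a - l0) (b - l0) (- (c + l0))).
  apply/seteqP; split=> q; rewrite /quadric /dquadric /mink /= !mxE /= => <-;
    by field; rewrite (lt0r_neq0 c_gt0) (ltr0_neq0 b_lt0) (lt0r_neq0 a_gt0).
split=> [|l1 l2 roots]; first exact: other_roots_exist cubicE.
rewrite (other_roots_eq cubicE roots) quadricE on_light_like_tangent_tropicE.
by rewrite normal_line_discriminant//; move: hp; rewrite quadricE.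
Qed.
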